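(* Let $t>0$ be a real number and let $M=(X,d)$ be a metric space. Then $M$ is complete if and only if the gravitational metric space $M_t=(X,d_t)$ is complete.
   Context: For a metric space $M=(X,d)$ and a real number $t>0$, the gravitational metric space $M_t=(X,d_t)$ is the set $X$ equipped with the metric $d_t(x,y)=\min\{2t,d(x,y)\}$ for all $x,y\in X$. *)

(* Defs.v *)
From HB Require Import structures.
From mathcomp Require Import all_boot all_order all_algebra.
From mathcomp Require Import all_classical all_reals topology.

Set Implicit Arguments.
Unset Strict Implicit.
Unset Printing Implicit Defensive.

Import Order.TTheory GRing.Theory Num.Theory.
Import numFieldTopology.Exports.

Local Open Scope classical_set_scope.
Local Open Scope ring_scope.

(* The limit is quantified explicitly because the library's [cvg] and
   [completeType] are restricted to pointed types, hence exclude the empty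
   space. *)
Definition complete_metric (R : realType) (M : metricType R) : Prop :=
  forall u : nat -> M, cauchy (u @ \oo) -> exists l : M, u @ \oo --> l.

Lemma cauchy_seqE (R : realType) (M : metricType R) (u : nat -> M) :
  cauchy (u @ \oo) <->
  forall e : R, 0 < e -> exists N : nat, forall m n : nat,
    (N <= m)%N -> (N <= n)%N -> mdist (u m) (u n) < e.
Proof.
split=> [/cauchy_ballP cu e e0|cu].
  have [[A B] /= [[N _ NA] [N' _ NB]] AB] := cu e e0.
  exists (maxn N N') => m n; rewrite !geq_max => /andP[Nm _] /andP[_ Nn].
  have := AB (u m, u n) (conj (NA m Nm) (NB n Nn)).
  by rewrite /= ballEmdist.
apply/cauchy_ballP => e e0; have [N uN] := cu e e0.
exists ([set u n | n in [set n | (N <= n)%N]],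
        [set u n | n in [set n | (N <= n)%N]]) => /=.
  by split; exists N => // n /= Nn; exists n.
move=> [_ _] /= [[m Nm <-] [n Nn <-]].
by rewrite ballEmdist /=; exact: uN.
Qed.

(* A type alias of the carrier, so that it can bear a second metric (and the
   topology and uniformity induced by it). *)
Definition gravitational (R : realType) (t : R) (t0 : 0 < t)
  (M : metricType R) : Type := M.

Section gravitational_metric.
Context {R : realType} {t : R} (t0 : 0 < t) (M : metricType R).

HB.instance Definition _ := Choice.copy (gravitational t0 M) M.

Definition gravitational_dist (x y : gravitational t0 M) : R :=
  Num.min (2 * t) (mdist (x : M) (y : M)).

Let distxx x : gravitational_dist x x = 0.
Proof. by rewrite /gravitational_dist mdistxx min_r// mulr_ge0// ltW. Qed.

Let dist_positivity x y : gravitational_dist x y = 0 -> x = y.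
Proof.
rewrite /gravitational_dist minEle; case: ifPn => _.
  by move/eqP; rewrite mulf_eq0 pnatr_eq0 (gt_eqF t0).
exact: mdist_positivity.
Qed.

Let dist_sym x y : gravitational_dist x y = gravitational_dist y x.
Proof. by rewrite /gravitational_dist metric_sym. Qed.

Let dist_triangle y x z :
  gravitational_dist x z <= gravitational_dist x y + gravitational_dist y z.
Proof.
rewrite /gravitational_dist.
have tri := @metric_triangle R M x y z.
have p1 := @mdist_ge0 R M x y; have p2 := @mdist_ge0 R M y z.
have tt : 0 <= 2 * t by rewrite mulr_ge0// ltW.
rewrite ge_min; case: (leP (2 * t) (mdist (x : M) y)) => _;
  case: (leP (2 * t) (mdist (y : M) z)) => _; apply/orP.
- by left; rewrite lerDl.
- by left; rewrite lerDl.
- by left; rewrite lerDr.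
- by right.
Qed.

HB.instance Definition _ := @isMetric.Build R (gravitational t0 M)
  gravitational_dist distxx dist_positivity dist_sym dist_triangle.

Lemma gravitational_mdistE (x y : gravitational t0 M) :
  mdist x y = Num.min (2 * t) (mdist (x : M) (y : M)).
Proof. by []. Qed.

End gravitational_metric.

(* Main.v *)
Require Import Defs.
From mathcomp Require Import all_boot all_order all_algebra.
From mathcomp Require Import all_classical all_reals topology.
Import Order.TTheory GRing.Theory Num.Theory.
Local Open Scope ring_scope.

(** Completeness only speaks of arbitrarily small distances, and truncating a
    metric at [2 * t] leaves every distance below [2 * t] unchanged: for
    [e <= 2 * t] the two metrics have the same balls of radius [e]
    ([gravitational_mdist_lt]).  Both the Cauchy property and convergence are
    stated for all [e > 0], and in both it suffices to treat the radii
    [e <= 2 * t], so a sequence is Cauchy for one metric iff it is for the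
    other ([gravitational_cauchy]), and converges to the same limits
    ([gravitational_cvg]).  The equivalence follows at once. *)

Lemma cvg_seq_mdistE {R : realType} {M : metricType R} (u : nat -> M) (l : M) :
  (u @ \oo --> l)%classic <->
  forall e : R, 0 < e -> exists N : nat, forall n : nat,
    (N <= n)%N -> mdist l (u n) < e.
Proof.
split=> [/cvg_ballP ul e e0|ul].
  have [N _ uN] := ul e e0.
  by exists N => n Nn; have := uN n Nn; rewrite /= ballEmdist.
apply/cvg_ballP => e e0; have [N uN] := ul e e0.
by exists N => // n /= Nn; rewrite ballEmdist; exact: uN.
Qed.

Section gravitational.
Context {R : realType} {t : R} (t0 : 0 < t) (M : metricType R).
Local Notation Mt := (gravitational t0 M).

Lemma gravitational_mdist_lt (x y : M) (e : R) : e <= 2 * t ->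
  (mdist (x : Mt) (y : Mt) < e) = (mdist x y < e).
Proof. by move=> et; rewrite gravitational_mdistE gt_min ltNge et. Qed.

Lemma gravitational_mdist_le (x y : M) : mdist (x : Mt) (y : Mt) <= mdist x y.
Proof. by rewrite gravitational_mdistE ge_min lexx orbT. Qed.

(** The identity from the truncated space back to [M] is uniformly continuous:
    capping the radius at the truncation threshold reduces to the case where
    the two metrics have the same balls.  The converse direction is immediate
    from [gravitational_mdist_le]. *)
Lemma gravitational_small_radius (e : R) : 0 < e ->
  exists2 e' : R, 0 < e' & forall x y : M,
    mdist (x : Mt) (y : Mt) < e' -> mdist x y < e.
Proof.
move=> e0; exists (Num.min e (2 * t)); first by rewrite lt_min e0 mulr_gt0.
move=> x y; rewrite gravitational_mdist_lt ?ge_min ?lexx ?orbT//.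
by rewrite lt_min => /andP[].
Qed.

Lemma gravitational_cauchy (u : nat -> M) :
  cauchy ((u : nat -> Mt) @ \oo)%classic <-> cauchy (u @ \oo)%classic.
Proof.
split=> /cauchy_seqE cu; apply/cauchy_seqE => e e0.
  have [e' e'0 ee'] := gravitational_small_radius _ e0.
  by have [N uN] := cu e' e'0; exists N => m n Nm Nn; exact/ee'/uN.
have [N uN] := cu e e0; exists N => m n Nm Nn.
exact: le_lt_trans (gravitational_mdist_le _ _) (uN m n Nm Nn).
Qed.

Lemma gravitational_cvg (u : nat -> M) (l : M) :
  ((u : nat -> Mt) @ \oo --> (l : Mt))%classic <-> (u @ \oo --> l)%classic.
Proof.
split=> /cvg_seq_mdistE ul; apply/cvg_seq_mdistE => e e0.
  have [e' e'0 ee'] := gravitational_small_radius _ e0.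
  by have [N uN] := ul e' e'0; exists N => n Nn; exact/ee'/uN.
have [N uN] := ul e e0; exists N => n Nn.
exact: le_lt_trans (gravitational_mdist_le _ _) (uN n Nn).
Qed.

End gravitational.

Theorem theorem4 (R : realType) (t : R) (t0 : 0 < t) (M : metricType R) :
  complete_metric M <-> complete_metric (gravitational t0 M).
Proof.
split=> cM u.
  by move=> /gravitational_cauchy /cM[l ul]; exists l; exact/gravitational_cvg.
move=> /(gravitational_cauchy t0) /cM[l ul].
by exists l; exact/(gravitational_cvg t0).
Qed.
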